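(* Let $\Lambda\in\mathcal{C}$ and $A\in\mathbb{R}^2\subset\mathcal{C}$. For each $N\ge1$ let $s_N$ be the sum of $N$ free independent type B Bernoulli variables with rate $\frac{\Lambda}{N}$ and jump size $A$ (in some non-commutative probability space of type B). Then the limit distribution of $s_N$ for $N\to\infty$ has cumulants given by $\kappa_n=\Lambda A^n$, $n\ge1$; that is, for every $n\ge1$, $$\lim_{N\to\infty}\kappa_n(s_N)=\Lambda A^n$$ (products and powers taken in $\mathcal{C}$).
   Context: A non-commutative probability space of type B is a system $(\mathcal{A},\varphi,\mathcal{X},f,\Phi)$ where $\mathcal{A}$ is a complex unital algebra, $\varphi:\mathcal{A}\to\mathbb{C}$ is linear with $\varphi(1)=1$, $\mathcal{X}$ is a complex vector space, $f:\mathcal{X}\to\mathbb{C}$ is linear, and $\Phi:\mathcal{A}\times\mathcal{X}\times\mathcal{A}\to\mathcal{X}$ is a two-sided action of $\mathcal{A}$ on $\mathcal{X}$ (an $\mathcal{A}$-bimodule structure), written $a\xi b=\Phi(a,\xi,b)$. The vector space $\mathcal{A}\times\mathcal{X}$ is a unital algebra with multiplication $(a,\xi)\cdot(b,\eta)=(ab,a\eta+\xi b)$. $\mathcal{C}$ is the commutative unital algebra $\mathbb{C}\times\mathbb{C}$ (with componentwise vector space structure) with multiplication $(x,t)\cdot(y,s)=(xy,xs+ty)$ and unit $(1,0)$; $\mathbb{R}^2$ is viewed as the subset $\mathbb{R}\times\mathbb{R}$ of $\mathcal{C}$. Limits in $\mathcal{C}$ are componentwise. Define $E:\mathcal{A}\times\mathcal{X}\to\mathcal{C}$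 by $E(a,\xi)=(\varphi(a),f(\xi))$. The type B non-crossing cumulants are the multilinear maps $\kappa_n:(\mathcal{A}\times\mathcal{X})^n\to\mathcal{C}$, $n\ge1$, determined by $$\sum_{\gamma\in NC(n)}\ \prod_{B\in\gamma}\kappa_{|B|}\big((a_1,\xi_1),\dots,(a_n,\xi_n)\,|\,B\big)=E\big((a_1,\xi_1)\cdots(a_n,\xi_n)\big)$$ for all $n\geq 1$, $a_i\in\mathcal{A}$, $\xi_i\in\mathcal{X}$, where $NC(n)$ is the lattice of (ordinary, type A) non-crossing partitions of $\{1,\dots,n\}$, the notation $|\,B$ means keeping only the arguments with index in the block $B$, in increasing order, and the product on the left is in $\mathcal{C}$. Write $\kappa_n(s)=\kappa_n(s,\dots,s)$ for $s\in\mathcal{A}\times\mathcal{X}$. The distribution of $s$ is its sequence of moments $E(s^n)$, $n\ge1$, equivalently its sequence of cumulants $\kappa_n(s)$, $n\ge1$ (each determines the other through the formula above); limits of distributions are understood termwise. Free independence: let $\{\mathcal{A}_k\}$ be unital subalgebras of $\mathcal{A}$ and $\{\mathcal{X}_k\}$ linear subspaces of $\mathcal{X}$ with $\mathcal{X}_k$ invariant under the action of $\mathcal{A}_k$. The pairs $(\mathcal{A}_k,\mathcal{X}_k)$ are free independent if $\kappa_n((a_1,\xi_1),\dots,(a_n,\xi_n))=0$ whenever $a_l\in\mathcal{A}_{i_l}$, $\xi_l\in\mathcal{X}_{i_l}$ ($l=1,\dots,n$) and there exist $1\le s<t\le n$ with $i_s\ne i_t$. Elements $(a_k,\xi_k)$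 are free independent if there are free independent pairs $(\mathcal{A}_k,\mathcal{X}_k)$ with $a_k\in\mathcal{A}_k$, $\xi_k\in\mathcal{X}_k$. An element $(a,\xi)\in\mathcal{A}\times\mathcal{X}$ is type B Bernoulli with rate $\Lambda\in\mathcal{C}$ and jump size $A=(\alpha_1,\alpha_2)\in\mathbb{R}^2\subset\mathcal{C}$ if $E\big((a,\xi)^n\big)=\Lambda A^n$ for all $n\ge1$. *)

(* Defs.v *)
From HB Require Import structures.
From mathcomp Require Import all_classical all_reals all_analysis.
From mathcomp Require Import all_boot all_order all_algebra.
From mathcomp Require Import complex.

Set Implicit Arguments.
Unset Strict Implicit.
Unset Printing Implicit Defensive.

Import Order.TTheory GRing.Theory Num.Theory.
Import numFieldNormedType.Exports.

Local Open Scope complex_scope.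
Local Open Scope ring_scope.

(* A pair type with the product module structure but no ring structure: the
   componentwise product that mathcomp puts on [U * V] must not be inferred
   on the two algebras below. *)
Record mpair (U V : Type) := MPair { mfst : U; msnd : V }.

Definition mpair_pair (U V : Type) (u : mpair U V) := (mfst u, msnd u).
Definition pair_mpair (U V : Type) (u : U * V) := MPair u.1 u.2.
Fact mpair_pairK (U V : Type) : cancel (@mpair_pair U V) (@pair_mpair U V).
Proof. by case. Qed.

Fact mpairP (U V : Type) (u v : mpair U V) :
  mfst u = mfst v -> msnd u = msnd v -> u = v.
Proof. by case: u v => [? ?] [? ?] /= -> ->. Qed.

HB.instance Definition _ (U V : choiceType) :=
  Choice.copy (mpair U V) (can_type (@mpair_pairK U V)).

Section MPair.
Variables (K : pzRingType) (U V : lmodType K).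
Local Notation W := (mpair U V).

Definition mpair_zero : W := MPair 0 0.
Definition mpair_opp (u : W) : W := MPair (- mfst u) (- msnd u).
Definition mpair_add (u v : W) : W := MPair (mfst u + mfst v) (msnd u + msnd v).
Definition mpair_scale (k : K) (u : W) : W := MPair (k *: mfst u) (k *: msnd u).

Fact mpair_addA : associative mpair_add.
Proof. by move=> u v w; apply: mpairP; rewrite /= addrA. Qed.
Fact mpair_addC : commutative mpair_add.
Proof. by move=> u v; apply: mpairP; rewrite /= addrC. Qed.
Fact mpair_add0 : left_id mpair_zero mpair_add.
Proof. by move=> u; apply: mpairP; rewrite /= add0r. Qed.
Fact mpair_addN : left_inverse mpair_zero mpair_opp mpair_add.
Proof. by move=> u; apply: mpairP; rewrite /= addNr. Qed.

HB.instance Definition _ := GRing.isZmodule.Build W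
  mpair_addA mpair_addC mpair_add0 mpair_addN.

Fact mpair_scaleA k l u : mpair_scale k (mpair_scale l u) = mpair_scale (k * l) u.
Proof. by apply: mpairP; rewrite /= scalerA. Qed.
Fact mpair_scale1 : left_id 1 mpair_scale.
Proof. by move=> u; apply: mpairP; rewrite /= scale1r. Qed.
Fact mpair_scaleDr : right_distributive mpair_scale +%R.
Proof. by move=> k u v; apply: mpairP; rewrite /= scalerDr. Qed.
Fact mpair_scaleDl u : {morph mpair_scale^~ u : k l / k + l}.
Proof. by move=> k l; apply: mpairP; rewrite /= scalerDl. Qed.

HB.instance Definition _ := GRing.Zmodule_isLmodule.Build K W
  mpair_scaleA mpair_scale1 mpair_scaleDr mpair_scaleDl.

End MPair.

(* [R[i]^o] is [R[i]] as a module over itself, with its norm topology. *)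
Definition typeBC (R : realType) : Type := mpair R[i]^o R[i]^o.

Section TypeBC.
Variable R : realType.
Local Notation C := R[i].
Local Notation CB := (typeBC R).

HB.instance Definition _ := GRing.Lmodule.copy CB (mpair C^o C^o).

Definition typeBC_one : CB := MPair 1 0.
Definition typeBC_mul (u v : CB) : CB :=
  MPair (mfst u * mfst v) (mfst u * msnd v + msnd u * mfst v).

Fact typeBC_mulA : associative typeBC_mul.
Proof.
move=> u v w; apply: mpairP => /=; first exact: mulrA.
by rewrite mulrDr mulrDl !mulrA addrA.
Qed.

Fact typeBC_mulC : commutative typeBC_mul.
Proof.
move=> u v; apply: mpairP => /=; first exact: mulrC.
by rewrite addrC; congr (_ + _); exact: mulrC.
Qed.

Fact typeBC_mul1 : left_id typeBC_one typeBC_mul.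
Proof.
by move=> u; apply: mpairP; rewrite /= !mul1r // mul0r addr0.
Qed.

Fact typeBC_mulDl : left_distributive typeBC_mul +%R.
Proof.
move=> u v w; apply: mpairP => /=; first exact: mulrDl.
by rewrite !mulrDl addrACA.
Qed.

Fact typeBC_one_neq0 : typeBC_one != 0.
Proof. by apply/eqP => /(congr1 (@mfst _ _))/eqP; rewrite oner_eq0. Qed.

HB.instance Definition _ := GRing.Zmodule_isComNzRing.Build CB
  typeBC_mulA typeBC_mulC typeBC_mul1 typeBC_mulDl typeBC_one_neq0.

Fact typeBC_scaleAl (k : C) (u v : CB) : k *: (u * v : CB) = (k *: u : CB) * v.
Proof.
apply: mpairP => /=; first exact: mulrA.
by rewrite scalerDr /GRing.scale /= !mulrA.
Qed.

HB.instance Definition _ := GRing.Lmodule_isLalgebra.Build C CB typeBC_scaleAl.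
HB.instance Definition _ := GRing.Lalgebra_isComAlgebra.Build C CB.

Definition typeBC_cvg (u : nat -> CB) (l : CB) : Prop :=
  ((fun N => mfst (u N)) @ \oo --> mfst l)%classic /\
  ((fun N => msnd (u N)) @ \oo --> msnd l)%classic.

End TypeBC.

Record ncpsB (R : realType) := NcpsB {
  nc_alg : algType R[i];
  nc_phi : {scalar nc_alg};
  nc_vec : lmodType R[i];
  nc_f : {scalar nc_vec};
  nc_act : nc_alg -> nc_vec -> nc_alg -> nc_vec;
  nc_phi1 : nc_phi 1 = 1;
  nc_act_linearl : forall xi b, linear (fun a => nc_act a xi b);
  nc_act_linearm : forall a b, linear (fun xi => nc_act a xi b);
  nc_act_linearr : forall a xi, linear (fun b => nc_act a xi b);
  nc_act1 : forall xi, nc_act 1 xi 1 = xi;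
  nc_actA : forall a b xi c d,
    nc_act a (nc_act b xi c) d = nc_act (a * b) xi (c * d)
}.

Definition nc_space (R : realType) (P : ncpsB R) : Type :=
  mpair (nc_alg P) (nc_vec P).

Section NcSpace.
Variables (R : realType) (P : ncpsB R).
Local Notation C := R[i].
Local Notation V := (nc_space P).
Local Notation act := (@nc_act R P).

HB.instance Definition _ := GRing.Lmodule.copy V (mpair (nc_alg P) (nc_vec P)).

Definition nc_one : V := MPair 1 0.

(* The one-sided actions are [a eta = act a eta 1] and [xi b = act 1 xi b]. *)
Definition nc_mul (u v : V) : V :=
  MPair (mfst u * mfst v) (act (mfst u) (msnd v) 1 + act 1 (msnd u) (mfst v)).

Let actDl xi b : {morph (fun a => act a xi b) : x y / x + y}.
Proof. by move=> x y /=; have := nc_act_linearl xi b 1 x y; rewrite !scale1r. Qed.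
Let actDm a b : {morph (fun xi => act a xi b) : x y / x + y}.
Proof. by move=> x y /=; have := nc_act_linearm a b 1 x y; rewrite !scale1r. Qed.
Let actDr a xi : {morph (fun b => act a xi b) : x y / x + y}.
Proof. by move=> x y /=; have := nc_act_linearr a xi 1 x y; rewrite !scale1r. Qed.
Let act0m a b : act a 0 b = 0.
Proof. by apply: (addrI (act a 0 b)); rewrite -actDm !addr0. Qed.
Let actZl k xi b a : act (k *: a) xi b = k *: act a xi b.
Proof.
have act0 : act 0 xi b = 0 by apply: (addrI (act 0 xi b)); rewrite -actDl !addr0.
by have := nc_act_linearl xi b k a 0; rewrite !addr0 act0 addr0.
Qed.
Let actZm k xi b a : act a (k *: xi) b = k *: act a xi b.
Proof. by have := nc_act_linearm a b k xi 0; rewrite !addr0 act0m addr0. Qed.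
Let actZr k xi b a : act a xi (k *: b) = k *: act a xi b.
Proof.
have act0 : act a xi 0 = 0 by apply: (addrI (act a xi 0)); rewrite -actDr !addr0.
by have := nc_act_linearr a xi k b 0; rewrite !addr0 act0 addr0.
Qed.

Fact nc_mulA : associative nc_mul.
Proof.
move=> u v w; apply: mpairP => /=; first exact: mulrA.
by rewrite !actDm !nc_actA !mul1r !mulr1 addrA.
Qed.

Fact nc_mul1l : left_id nc_one nc_mul.
Proof.
by move=> u; apply: mpairP; rewrite /= ?mul1r // nc_act1 act0m addr0.
Qed.

Fact nc_mul1r : right_id nc_one nc_mul.
Proof.
by move=> u; apply: mpairP; rewrite /= ?mulr1 // nc_act1 act0m add0r.
Qed.

Fact nc_mulDl : left_distributive nc_mul +%R.
Proof.
move=> u v w; apply: mpairP => /=; first exact: mulrDl.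
by rewrite actDl actDm addrACA.
Qed.

Fact nc_mulDr : right_distributive nc_mul +%R.
Proof.
move=> u v w; apply: mpairP => /=; first exact: mulrDr.
by rewrite actDr actDm addrACA.
Qed.

Fact nc_one_neq0 : nc_one != 0.
Proof.
apply/eqP => /(congr1 (@mfst _ _)) /= one0; have := nc_phi1 P.
by rewrite one0 linear0 => /eqP; rewrite eq_sym oner_eq0.
Qed.

HB.instance Definition _ := GRing.Zmodule_isNzRing.Build V
  nc_mulA nc_mul1l nc_mul1r nc_mulDl nc_mulDr nc_one_neq0.

Fact nc_scaleAl (k : C) (u v : V) : k *: (u * v : V) = (k *: u : V) * v.
Proof.
apply: mpairP => /=; first exact: scalerAl.
by rewrite scalerDr actZl actZm.
Qed.

HB.instance Definition _ := GRing.Lmodule_isLalgebra.Build C V nc_scaleAl.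

Fact nc_scaleAr (k : C) (u v : V) : k *: (u * v) = u * (k *: v).
Proof.
apply: mpairP => /=; first exact: scalerAr.
by rewrite scalerDr actZm actZr.
Qed.

HB.instance Definition _ := GRing.Lalgebra_isAlgebra.Build C V nc_scaleAr.

Definition nc_E (u : V) : typeBC R := MPair (nc_phi P (mfst u)) (nc_f P (msnd u)).

Fact nc_E_linear : linear nc_E.
Proof. by move=> k u v; apply: mpairP; rewrite /= linearP. Qed.

HB.instance Definition _ :=
  GRing.isLinear.Build C V (typeBC R) _ nc_E nc_E_linear.

End NcSpace.

Definition noncrossing (n : nat) (G : {set {set 'I_n}}) : bool :=
  [forall A in G, forall B in G,
    [forall i in A, forall j in B, forall k in A, forall l in B,
      [&& i < j, j < k & k < l]%N ==> (A == B)]].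

Definition NC (n : nat) : {set {set {set 'I_n}}} :=
  [set G | partition G [set: 'I_n] && noncrossing G].

(* The values at the indices of [B], in increasing order: [enum_val]
   enumerates a set of ordinals increasingly. *)
Definition restr (T : Type) (n : nat) (x : 'I_n -> T) (B : {set 'I_n}) :
  'I_#|B| -> T := fun i => x (enum_val i).

Arguments restr {T n} x B i.

Definition subst_arg (T : Type) (n : nat) (x : 'I_n -> T) (i : 'I_n) (u : T) :
  'I_n -> T := fun j => if j == i then u else x j.

Definition multilinear (K : pzRingType) (U V : lmodType K) (n : nat)
    (g : ('I_n -> U) -> V) : Prop :=
  forall (x : 'I_n -> U) (i : 'I_n), linear (fun u : U => g (subst_arg x i u)).

Fact NC_block (n : nat) (G : {set {set 'I_n}}) (B : {set 'I_n}) :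
  G \in NC n -> G != [set [set: 'I_n]] -> B \in G -> (0 < #|B| < n)%N.
Proof.
rewrite inE => /andP[/and3P[_ /trivIsetP tG n0] _] nT BG; apply/andP; split.
  by rewrite card_gt0; apply: contraNneq n0 => <-.
rewrite ltn_neqAle -[X in (_ <= X)%N]card_ord max_card andbT.
apply: contra nT => /eqP cB.
have BT : B = [set: 'I_n].
  by apply/eqP; rewrite eqEcard subsetT cardsT card_ord cB /=.
apply/eqP/setP => A; rewrite inE -BT; apply/idP/eqP => [AG|-> //].
apply/eqP; apply: contraNT n0 => AB.
by have := tG A B AG BG AB; rewrite -setI_eq0 BT setIT => /eqP <-.
Qed.

Fact NC_one (n : nat) : (0 < n)%N -> [set [set: 'I_n]] \in NC n.
Proof.
move=> n0; rewrite inE; apply/andP; split.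
  rewrite /partition /cover big_set1 eqxx trivIset1 inE /=.
  by apply/eqP => e; have := cardsT 'I_n; rewrite -e cards0 card_ord => n1; rewrite -n1 in n0.
apply/'forall_implyP => A; rewrite inE => /eqP ->.
apply/'forall_implyP => B; rewrite inE => /eqP ->.
do 4 (apply/'forall_implyP => ? _).
by apply/implyP.
Qed.

Section Cumulants.
Variables (R : realType) (P : ncpsB R).
Local Notation V := (nc_space P).
Local Notation CB := (typeBC R).

Definition moment_cumulant (kappa : forall n, ('I_n -> V) -> CB) : Prop :=
  forall (n : nat) (x : 'I_n -> V), (0 < n)%N ->
    \sum_(G in NC n) \prod_(B in G) kappa #|B| (restr x B) =
    nc_E (\prod_(i < n) x i).

(* Solves the moment-cumulant formula for the term of the one-block partition;
   [m] bounds the recursion depth. *)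
Fixpoint cumulant_rec (m n : nat) (x : 'I_n -> V) : CB :=
  if m is m'.+1 then
    nc_E (\prod_(i < n) x i) -
    \sum_(G in NC n | G != [set [set: 'I_n]])
      \prod_(B in G) cumulant_rec m' (restr x B)
  else 0.

Definition cumulant (n : nat) (x : 'I_n -> V) : CB := cumulant_rec n x.

Fact cumulant_recE (m n : nat) (x : 'I_n -> V) : (0 < n <= m)%N ->
  cumulant_rec m x = cumulant x.
Proof.
rewrite /cumulant; suff: forall k m n (x : 'I_n -> V), (n <= k)%N ->
    (0 < n <= m)%N -> cumulant_rec m x = cumulant_rec k x.
  by move=> H ?; exact: H.
elim=> [|k IH] [|m'] n' y nk /andP[n0 nm].
- by [].
- by have := leq_trans n0 nk.
- by have := leq_trans n0 nm.
rewrite /=; congr (_ - _); apply: eq_bigr => G /andP[GN GT].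
apply: eq_bigr => B BG; have /andP[B0 Bn] := NC_block GN GT BG.
by apply: IH; rewrite ?B0 -ltnS (leq_trans Bn).
Qed.

Fact cumulant_restrT (kappa : forall n, ('I_n -> V) -> CB) n (x : 'I_n -> V) :
  kappa #|[set: 'I_n]| (restr x [set: 'I_n]) = kappa n x.
Proof.
have H m (e : m = n) (y : 'I_m -> V) : (forall i, y i = x (cast_ord e i)) ->
    kappa m y = kappa n x.
  by case: n / e x => x yx; congr kappa; apply/funext => i; rewrite yx cast_ord_id.
have e : #|[set: 'I_n]| = n by rewrite cardsT card_ord.
apply: (H _ e) => i; rewrite /restr; congr x; apply: val_inj => /=.
rewrite /enum_val.
have -> : enum [set: 'I_n] = enum 'I_n by apply: eq_enum => j; rewrite !inE.
by rewrite nth_enum_ord // -[X in (_ < X)%N]e.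
Qed.

Theorem cumulantP : moment_cumulant (@cumulant).
Proof.
case=> // n x n0; rewrite (bigD1 [set [set: 'I_n.+1]]) ?NC_one //= big_set1.
rewrite (cumulant_restrT (@cumulant)) {1}/cumulant /=.
rewrite -[RHS](subrK (\sum_(G in NC n.+1 | G != [set [set: 'I_n.+1]])
      \prod_(B in G) cumulant_rec n (restr x B))); congr (_ + _).
apply: eq_bigr => G /andP[GN GT]; apply: eq_bigr => B BG.
by rewrite cumulant_recE // -ltnS (NC_block GN GT BG).
Qed.

Theorem cumulant_unique (kappa : forall n, ('I_n -> V) -> CB) :
  moment_cumulant kappa ->
  forall n (x : 'I_n -> V), (0 < n)%N -> kappa n x = cumulant x.
Proof.
move=> kP n; elim/ltn_ind: n => n IH x n0.
have := kP n x n0; rewrite -(cumulantP x n0).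
rewrite !(bigD1 (P := fun G => G \in NC n) [set [set: 'I_n]]) ?NC_one //=.
rewrite !big_set1 !cumulant_restrT.
move=> h; apply: (addIr _ (etrans h _)); congr (_ + _).
apply: eq_bigr => G /andP[GN GT]; apply: eq_bigr => B BG.
by have /andP[B0 Bn] := NC_block GN GT BG; rewrite IH.
Qed.

Fact restr_subst_in n (x : 'I_n -> V) (B : {set 'I_n}) (i : 'I_n) (u : V)
    (iB : i \in B) :
  restr (subst_arg x i u) B = subst_arg (restr x B) (enum_rank_in iB i) u.
Proof.
apply/funext => j; rewrite /restr /subst_arg; congr (if _ then _ else _).
by rewrite -(inj_eq enum_val_inj) enum_rankK_in.
Qed.

Fact restr_subst_out n (x : 'I_n -> V) (B : {set 'I_n}) (i : 'I_n) (u : V) :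
  i \notin B -> restr (subst_arg x i u) B = restr x B.
Proof.
move=> iB; apply/funext => j; rewrite /restr /subst_arg ifN //.
by apply: contraNneq iB => <-; exact: enum_valP.
Qed.

Theorem cumulant_multilinear n : multilinear (@cumulant n).
Proof.
elim/ltn_ind: n => n IH x i k u v /=.
have n0 : (0 < n)%N by case: i => m; case: n {IH x} => // .
have cE w : cumulant (subst_arg x i w) = nc_E (\prod_(j < n) subst_arg x i w j) -
    \sum_(G in NC n | G != [set [set: 'I_n]])
      \prod_(B in G) cumulant (restr (subst_arg x i w) B).
  rewrite -cumulantP // (bigD1 [set [set: 'I_n]]) ?NC_one //= big_set1.
  by rewrite cumulant_restrT addrK.
rewrite !cE scalerBr addrACA -opprD; congr (_ - _).
- rewrite -linearP; congr nc_E.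
  have [r1 [r2 [er i1 i2]]] : exists r1 r2, [/\ index_enum 'I_n = r1 ++ i :: r2,
      i \notin r1 & i \notin r2].
    have := index_enum_uniq 'I_n.
    case/splitPr: (mem_index_enum i) => r1 r2.
    rewrite cat_uniq /= negb_or => /and3P[_ /andP[i1 _] /andP[i2 _]].
    by exists r1, r2.
  have xE r w : i \notin r -> \prod_(j <- r) subst_arg x i w j = \prod_(j <- r) x j.
    move=> ir; apply: eq_big_seq => j jr; rewrite /subst_arg ifN //.
    by apply: contraNneq ir => <-.
  have pE w : \prod_(j < n) subst_arg x i w j =
      (\prod_(j <- r1) x j) * (w * \prod_(j <- r2) x j).
    by rewrite er big_cat big_cons !xE // {1}/subst_arg eqxx.
  by rewrite !pE mulrDl mulrDr -scalerAl -scalerAr.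
- rewrite scaler_sumr -big_split /=; apply: eq_bigr => G /andP[GN GT].
  have GP : partition G [set: 'I_n] by move: GN; rewrite inE => /andP[].
  have iG : i \in cover G by rewrite (cover_partition GP) inE.
  pose D := pblock G i; have DG : D \in G by rewrite pblock_mem.
  have iD : i \in D by rewrite mem_pblock.
  rewrite !(bigD1 (P := fun B => B \in G) D) //=.
  have oE w : \prod_(B in G | B != D) cumulant (restr (subst_arg x i w) B) =
              \prod_(B in G | B != D) cumulant (restr x B).
    apply: eq_bigr => B /andP[BG BD]; rewrite restr_subst_out //.
    apply: contra BD => iB; apply/eqP; symmetry; apply: def_pblock => //.
    by case/and3P: GP.
  rewrite !oE scalerAl -mulrDl !(restr_subst_in _ _ iD); congr (_ * _).
  by apply: IH; case/andP: (NC_block GN GT DG).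
Qed.

End Cumulants.

Section Freeness.
Variables (R : realType) (P : ncpsB R).
Local Notation V := (nc_space P).

Definition free_pairs (I : Type)
    (S : I -> {pred nc_alg P}) (W : I -> {pred nc_vec P}) : Prop :=
  [/\ forall k, GRing.subalg_closed (S k),
      forall k, GRing.submod_closed (W k),
      forall k a xi b, a \in S k -> xi \in W k -> b \in S k ->
        nc_act a xi b \in W k
    & forall (n : nat) (x : 'I_n -> V) (c : 'I_n -> I),
        (forall l, mfst (x l) \in S (c l) /\ msnd (x l) \in W (c l)) ->
        (exists s t : 'I_n, (s < t)%N /\ c s <> c t) ->
        cumulant x = 0].

Definition free_independent (I : Type) (x : I -> V) : Prop :=
  exists (S : I -> {pred nc_alg P}) (W : I -> {pred nc_vec P}),
    free_pairs S W /\ forall k, mfst (x k) \in S k /\ msnd (x k) \in W k.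

Definition bernoulli (rate : typeBC R) (jump : R * R) (u : V) : Prop :=
  let A : typeBC R := MPair jump.1%:C jump.2%:C in
  forall n : nat, (0 < n)%N -> nc_E (u ^+ n) = rate * A ^+ n.

End Freeness.

(* Main.v *)
Require Import Defs.
From mathcomp Require Import all_classical all_reals all_analysis.
From mathcomp Require Import all_boot all_order all_algebra.
From mathcomp Require Import complex.
Import Order.TTheory GRing.Theory Num.Theory.
Import numFieldNormedType.Exports.
Local Open Scope complex_scope.
Local Open Scope ring_scope.

(** The poissonian limit theorem is a statement about small moments: if all
    the moments of a variable are proportional to a small parameter [t], then
    its cumulants agree with its moments up to terms of order [t ^+ 2].

    The reason is the moment-cumulant formula.  The one-block partition
    contributes the cumulant itself; every other noncrossing partition has at
    least two blocks, and by induction each block contributes a factor [t].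
    Keeping track of the dependence on [t], the [n]-th cumulant is
    [t *: q.[t%:A]] for a polynomial [q] over the commutative algebra
    [typeBC R] which depends on the moments only, not on the ambient space,
    and whose constant term is the [n]-th moment divided by [t]
    ([cumulant_small_moments]).

    On the other hand multilinearity and the vanishing of mixed cumulants make
    cumulants additive on free families ([cumulant_free_sum]).  With [t] equal
    to [N%:R^-1], the sum of [N] free variables therefore has [n]-th cumulant
    [N%:R *: (t *: q.[t%:A])], that is [q.[t%:A]], which tends to [q.[0]]
    because polynomial maps are continuous ([typeBC_cvg_horner]). *)

Lemma multilinear_sum (K : pzRingType) (U V : lmodType K) (n : nat)
    (g : ('I_n -> U) -> V) (w : 'I_n -> U) (i : 'I_n) (I : finType) (y : I -> U) :
  multilinear g ->
  g (subst_arg w i (\sum_k y k)) = \sum_k g (subst_arg w i (y k)).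
Proof.
move=> gP; pose h u := g (subst_arg w i u).
have hD u v : h (u + v) = h u + h v.
  by have := gP w i 1 u v; rewrite /= !scale1r.
have h0 : h 0 = 0 by apply: (addrI (h 0)); rewrite -hD !addr0.
exact: (big_morph h hD h0).
Qed.

(** Only the slots in [D] are expanded, the others being frozen to the indices
    [c0].  This form makes the induction on the number of slots of [D] work:
    expanding one more slot with index [k] moves it out of [D] and updates
    [c0] at that slot. *)
Lemma multilinear_expand (K : pzRingType) (U V : lmodType K) (n : nat)
    (g : ('I_n -> U) -> V) (I : finType) (y : I -> U) (D : {set 'I_n})
    (c0 : 'I_n -> I) :
  multilinear g ->
  g (fun i => if i \in D then \sum_k y k else y (c0 i)) =
  \sum_(c : {ffun 'I_n -> I} | [forall i, (i \in D) || (c i == c0 i)])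
    g (y \o c).
Proof.
move=> gP; move: {2}#|D| (leqnn #|D|) => m; elim: m D c0 => [|m IH] D c0 Dm.
  have -> : D = set0 by apply/eqP; rewrite -cards_eq0 -leqn0.
  rewrite (big_pred1 [ffun i => c0 i]) => [|c].
    by congr g; apply/funext => i; rewrite inE /= ffunE.
  apply/forallP/eqP => [cc0|-> i]; last by rewrite ffunE eqxx orbT.
  by apply/ffunP => i; rewrite ffunE; have := cc0 i; rewrite inE => /eqP.
have [->|[i iD]] := set_0Vmem D; first by apply: IH; rewrite cards0.
set w := fun j : 'I_n => _.
have -> : g w = g (subst_arg w i (\sum_k y k)).
  congr g; apply/funext => j; rewrite /subst_arg /w.
  by have [->|//] := eqVneq j i; rewrite iD.
rewrite (multilinear_sum _ _ _ _ _ _ _ _ _ gP).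
rewrite [RHS](partition_big (fun c : {ffun 'I_n -> I} => c i) xpredT) //=.
apply: eq_bigr => k _.
pose ck j := if j == i then k else c0 j.
have -> : g (subst_arg w i (y k)) =
    g (fun j => if j \in D :\ i then \sum_k y k else y (ck j)).
  congr g; apply/funext => j; rewrite /subst_arg /w /ck !inE.
  by have [|] := eqVneq j i.
rewrite IH; last by move: Dm; rewrite (cardsD1 i) iD.
apply: eq_bigl => c; apply/forallP/andP => [cP|[/forallP cP /eqP cik] j].
  split; last by have := cP i; rewrite !inE /ck eqxx.
  apply/forallP => j; have := cP j; rewrite !inE /ck.
  by have [->|] := eqVneq j i; rewrite ?iD.
by have := cP j; rewrite !inE /ck; have [->|//] := eqVneq j i; rewrite cik eqxx.
Qed.

(** Expand the first slot, giving one term for each [k]; in the expansion of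
    the remaining slots every word of indices other than the constant word [k]
    is mixed, so that freeness kills its cumulant. *)
Lemma cumulant_free_sum (R : realType) (P : ncpsB R) (I : finType)
    (x : I -> nc_space P) (n : nat) :
  free_independent x -> (0 < n)%N ->
  cumulant (fun _ : 'I_n => \sum_k x k) =
  \sum_k cumulant (fun _ : 'I_n => x k).
Proof.
case: n => // n [S [W [[_ _ _ vanish] xSW]]] _.
pose g := @cumulant R P n.+1.
have gP : multilinear g := @cumulant_multilinear R P n.+1.
pose w := fun _ : 'I_n.+1 => \sum_k x k.
transitivity (g (subst_arg w ord0 (\sum_k x k))).
  by congr g; apply/funext => j; rewrite /subst_arg if_same.
rewrite (multilinear_sum _ _ _ _ _ _ _ _ _ gP); apply: eq_bigr => k _.
have -> : subst_arg w ord0 (x k) =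
    (fun j => if j \in [set~ ord0] then \sum_k x k else x k).
  by apply/funext => j; rewrite /subst_arg !inE; case: eqVneq.
rewrite (multilinear_expand _ _ _ _ _ _ _ _ (fun=> k) gP).
rewrite (bigD1 [ffun=> k]) /=; last by apply/forallP => j; rewrite ffunE eqxx orbT.
rewrite [X in _ + X]big1 ?addr0 => [|c /andP[/forallP cP ck]].
  by congr g; apply/funext => j; rewrite /= ffunE.
(* A word that starts with [k] and is not constant differs from [k] later. *)
have c0 : c ord0 = k by have := cP ord0; rewrite !inE eqxx => /eqP.
have [j cj] : exists j, c j != k.
  apply/existsP; apply: contraR ck; rewrite negb_exists => /forallP ck.
  by apply/eqP/ffunP => j; rewrite ffunE; apply/eqP/negPn/ck.
apply: (vanish _ _ c) => [l|]; first exact: xSW.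
exists ord0, j; split; last by rewrite c0; apply/eqP; rewrite eq_sym.
by rewrite lt0n; apply: contraNneq cj => j0; rewrite -c0; apply/eqP; congr (c _);
  apply: val_inj.
Qed.

Lemma NC_card_gt1 (n : nat) (G : {set {set 'I_n}}) :
  (0 < n)%N -> G \in NC n -> G != [set [set: 'I_n]] -> (1 < #|G|)%N.
Proof.
move=> n0; rewrite inE => /andP[/cover_partition GT _]; apply: contraR.
rewrite -leqNgt leq_eqVlt ltnS leqn0 cards_eq0 => /orP[/cards1P[B GB]|/eqP G0].
  by move: GT; rewrite GB /cover big_set1 => ->.
move: GT; rewrite G0 /cover big_set0 => /setP/(_ (Ordinal n0)).
by rewrite !inE.
Qed.

(** The polynomial [q] is chosen before the space and the variable: in the
    limit theorem both vary with [N] while [q] stays fixed.  Extracting the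
    factor [t] from the statement, rather than bounding a remainder, is what
    makes the constant term visible: a partition [G] contributes
    [t ^+ #|G|], hence a monomial of degree [#|G|.-1 > 0] to [q]. *)
Lemma cumulant_small_moments (R : realType) (mom : nat -> typeBC R) (n : nat) :
  (0 < n)%N ->
  exists q : {poly typeBC R}, q.[0] = mom n /\
    forall (P : ncpsB R) (u : nc_space P) (t : R[i]),
      (forall m, (0 < m)%N -> nc_E (u ^+ m) = t *: mom m) ->
      cumulant (fun _ : 'I_n => u) = t *: q.[t%:A].
Proof.
elim/ltn_ind: n => n IH n0.
have /choice[q qP] : forall m, exists q : {poly typeBC R}, (0 < m < n)%N ->
    forall (P : ncpsB R) (u : nc_space P) (t : R[i]),
      (forall m, (0 < m)%N -> nc_E (u ^+ m) = t *: mom m) ->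
      cumulant (fun _ : 'I_m => u) = t *: q.[t%:A].
  move=> m; have [/andP[m0 mn]|_] := boolP (0 < m < n)%N; last by exists 0.
  by have [q [_ qP]] := IH m mn m0; exists q.
exists ((mom n)%:P -
  \sum_(G in NC n | G != [set [set: 'I_n]])
    'X^(#|G|.-1) * \prod_(B in G) q #|B|); split=> [|P u t ut].
  rewrite hornerD hornerN hornerC horner_sum big1 ?subr0 // => G /andP[GN GT].
  rewrite hornerM hornerXn expr0n.
  by case: #|G| (NC_card_gt1 _ _ n0 GN GT) => [|[]] // m _; rewrite mul0r.
have := cumulantP (fun _ : 'I_n => u) n0.
rewrite (bigD1 [set [set: 'I_n]]) ?NC_one //= big_set1 cumulant_restrT.
rewrite prodr_const card_ord ut // => /(canRL (addrK _)) ->.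
rewrite hornerD hornerN hornerC horner_sum scalerBr; congr (_ - _).
rewrite scaler_sumr; apply: eq_bigr => G /andP[GN GT].
rewrite hornerM hornerXn horner_prod exprZn expr1n.
transitivity (\prod_(B in G) (t *: (q #|B|).[t%:A])).
  (* the restriction of a constant word is a constant word, definitionally *)
  by apply: eq_bigr => B BG; apply: qP (NC_block GN GT BG) _ _ _ ut.
rewrite scaler_prod prodr_const -scalerAl mul1r scalerA -exprS prednK //.
exact: ltnW (NC_card_gt1 _ _ n0 GN GT).
Qed.

Lemma typeBC_cvgD (R : realType) (u v : nat -> typeBC R) (l m : typeBC R) :
  typeBC_cvg u l -> typeBC_cvg v m -> typeBC_cvg (fun N => u N + v N) (l + m).
Proof.
by case=> u1 u2 [v1 v2]; split; [exact: (cvgD u1 v1)|exact: (cvgD u2 v2)].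
Qed.

Lemma typeBC_cvgM (R : realType) (u v : nat -> typeBC R) (l m : typeBC R) :
  typeBC_cvg u l -> typeBC_cvg v m -> typeBC_cvg (fun N => u N * v N) (l * m).
Proof.
case=> u1 u2 [v1 v2]; split; first exact: (cvgM u1 v1).
have h1 : (mfst (u N) * msnd (v N) @[N --> \oo] --> mfst l * msnd m)%classic.
  exact: (cvgM u1 v2).
have h2 : (msnd (u N) * mfst (v N) @[N --> \oo] --> msnd l * mfst m)%classic.
  exact: (cvgM u2 v1).
exact: (cvgD h1 h2).
Qed.

Lemma typeBC_cvg_horner (R : realType) (q : {poly typeBC R})
    (u : nat -> typeBC R) (l : typeBC R) :
  typeBC_cvg u l -> typeBC_cvg (fun N => q.[u N]) q.[l].
Proof.
move=> ul; elim/poly_ind: q => [|q c IH].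
  under eq_fun do rewrite horner0.
  by rewrite horner0; split; exact: cvg_cst.
under eq_fun do rewrite hornerMXaddC.
rewrite hornerMXaddC; apply: typeBC_cvgD; first exact: typeBC_cvgM.
by split; exact: cvg_cst.
Qed.


Lemma typeBC_cvg_ext_pos (R : realType) (u v : nat -> typeBC R) (l : typeBC R) :
  (forall N, (0 < N)%N -> v N = u N) -> typeBC_cvg u l -> typeBC_cvg v l.
Proof.
move=> vu [u1 u2]; split.
- apply: cvg_trans u1; apply: near_eq_cvg.
  by near=> N; rewrite vu //; near: N; exact: nbhs_infty_gt.
- apply: cvg_trans u2; apply: near_eq_cvg.
  by near=> N; rewrite vu //; near: N; exact: nbhs_infty_gt.
Unshelve. all: by end_near.
Qed.

Lemma typeBC_cvg_invn (R : realType) :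
  typeBC_cvg (fun N => (N%:R : R[i])^-1%:A : typeBC R) 0.
Proof.
split; last first.
  rewrite (_ : (fun N => _) = fun=> 0); first exact: cvg_cst.
  by apply/funext => N; rewrite /= scaler0.
apply/cvgr0Pnorm_lt => e e0.
(* a positive complex number is real, which reduces the claim to [R] *)
have eE : e = (complex.Re e)%:C by rewrite RRe_real // ger0_real // ltW.
have Re0 : 0 < complex.Re e by rewrite -ltcR -eE.
near=> N => /=.
have N0 : 0 < N%:R :> R.
  by rewrite ltr0n; near: N; exact: nbhs_infty_gt.
rewrite [_ *: 1]mulr1 normfV normr_nat eE.
rewrite -(rmorph_nat (real_complex R)) -fmorphV ltcR.
rewrite invf_plt ?posrE //.
near: N; exact: nbhs_infty_gtr.
Unshelve. all: by end_near.
Qed.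

Theorem theorem6p1 (R : realType) (Lambda : typeBC R) (alpha : R * R)
    (P : nat -> ncpsB R) (x : forall N : nat, 'I_N -> nc_space (P N)) :
  (forall N : nat, (0 < N)%N ->
     free_independent (x N) /\
     forall i : 'I_N,
       bernoulli ((N%:R : R[i])^-1 *: Lambda) alpha (x N i)) ->
  let s := fun N : nat => \sum_(i < N) x N i in
  let A : typeBC R := MPair alpha.1%:C alpha.2%:C in
  forall n : nat, (0 < n)%N ->
    typeBC_cvg (fun N => cumulant (fun _ : 'I_n => s N)) (Lambda * A ^+ n).
Proof.
move=> xP s A n n0.
have [q [q0 qP]] := cumulant_small_moments R (fun m => Lambda * A ^+ m) n n0.
rewrite -q0.
apply: (typeBC_cvg_ext_pos _ (fun N => q.[(N%:R : R[i])^-1%:A])); last first.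
  exact/typeBC_cvg_horner/typeBC_cvg_invn.
move=> N N0; have [xfree xbern] := xP N N0.
rewrite /s cumulant_free_sum //.
under eq_bigr => i _.
  rewrite (qP _ _ (N%:R)^-1); first over.
  by move=> m m0; rewrite scalerAl; exact: xbern.
rewrite sumr_const card_ord -scaler_nat scalerA mulfV ?scale1r //.
by rewrite pnatr_eq0 -lt0n.
Qed.
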